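(* Let $f:\mathbb{R}^n\to\mathbb{R}$ be continuously differentiable and segment smooth, let $c,\delta\in(0,1)$, let $w_k\in\mathbb{R}^n$, and let $\epsilon_k\ge 0$. Let $\eta_k>0$ be the step size returned by the equality line search at $w_k$ along the direction $-\nabla f(w_k)$ with parameters $c,\delta$, some initial step size $\eta_{k,0}>0$, and acceptance condition $$f(w_k-\eta\nabla f(w_k))\le f(w_k)-c\,\eta\,\|\nabla f(w_k)\|^2+\epsilon_k .$$ Then $$\eta_k\ \ge\ \frac{2\delta(1-c)}{l(w_k,\eta_{w_k})}.$$
   Context: Segment smoothness. For $f\in C^1(\mathbb{R}^n)$, $w\in\mathbb{R}^n$, $\eta>0$, put $w_\eta:=w-\eta\nabla f(w)$ and $$l(w,\eta):=\sup_{\hat\eta\in(0,\eta]}\frac{\|\nabla f(w)-\nabla f(w_{\hat\eta})\|}{\|w-w_{\hat\eta}\|},$$ with the convention $0/0=0$. The function $f$ is segment smooth if for every $w\in\mathbb{R}^n$ there is $\eta_w>0$ with $l(w,\eta_w)<\infty$. The value $\eta_w$ is moreover chosen such that $\eta_w\ge \frac{2}{l(w,\eta_w)}$; in particular, at the point $w_k$ considered, $l(w_k,\eta_{w_k})>0$. Equality line search. Inputs: $w_k,d_k\in\mathbb{R}^n$, $c,\delta\in(0,1)$, $\eta_{k,0}>0$, and $R_k\ge f(w_k)$ (here $d_k=-\nabla f(w_k)$ and $R_k=f(w_k)+\epsilon_k$). A step size $\eta$ is accepted if $f(w_k+\eta d_k)\le R_k+c\,\eta\,\nabla f(w_k)^Td_k$.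 If $\eta_{k,0}$ is not accepted, test $\delta\eta_{k,0},\delta^2\eta_{k,0},\dots$ and return the first accepted value. If $\eta_{k,0}$ is accepted, test $\delta^{-1}\eta_{k,0},\delta^{-2}\eta_{k,0},\dots$ until the first value $\delta^{-m}\eta_{k,0}$ that is not accepted, and return $\delta^{-m+1}\eta_{k,0}$. When $\eta_k$ is called the returned step size, it is understood that the procedure terminates. *)

(* Defs.v *)
From HB Require Import structures.
From mathcomp Require Import all_boot all_order all_algebra.
From mathcomp Require Import all_classical all_reals all_analysis.

Set Implicit Arguments.
Unset Strict Implicit.
Unset Printing Implicit Defensive.

Import Order.TTheory GRing.Theory Num.Theory.
Import numFieldNormedType.Exports.

Local Open Scope classical_set_scope.
Local Open Scope ring_scope.

Definition dot (R : realType) (n : nat) (u v : 'rV[R]_n) : R :=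
  \sum_(i < n) u 0 i * v 0 i.

(* The library norm `|u| on 'rV[R]_n is the sup norm, hence this definition.
   Both norms induce the same topology, so the library's [differentiable] and
   [continuous] are the usual notions. *)
Definition enorm (R : realType) (n : nat) (u : 'rV[R]_n) : R :=
  Num.sqrt (dot u u).

Definition grad (R : realType) (n : nat) (f : 'rV[R]_n -> R) (w : 'rV[R]_n)
    : 'rV[R]_n :=
  \row_(i < n) 'D_(delta_mx 0 i) f w.

Definition C1 (R : realType) (n : nat) (f : 'rV[R]_n -> R) : Prop :=
  (forall w, differentiable f w) /\ continuous (grad f).

Definition gd_step (R : realType) (n : nat) (f : 'rV[R]_n -> R)
    (w : 'rV[R]_n) (eta : R) : 'rV[R]_n :=
  w - eta *: grad f w.

(* The convention 0 / 0 = 0 is the library's x / 0 = 0; the denominator only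
   vanishes together with the numerator. *)
Definition segment_lip (R : realType) (n : nat) (f : 'rV[R]_n -> R)
    (w : 'rV[R]_n) (eta : R) : \bar R :=
  ereal_sup [set (enorm (grad f w - grad f (gd_step f w t)) /
                  enorm (w - gd_step f w t))%:E | t in `]0, eta] ].

Definition segment_smooth (R : realType) (n : nat) (f : 'rV[R]_n -> R) : Prop :=
  forall w, exists2 eta : R, 0 < eta & (segment_lip f w eta < +oo)%E.

Definition accepts (R : realType) (n : nat) (f : 'rV[R]_n -> R)
    (w d : 'rV[R]_n) (c Rk eta : R) : bool :=
  f (w + eta *: d) <= Rk + c * eta * dot (grad f w) d.

(* The search terminates with output eta.  The index j = 0 is the test of the
   initial step size, and m.+1 is the number of further tests. *)
Definition equality_line_search (R : realType) (n : nat) (f : 'rV[R]_n -> R)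
    (w d : 'rV[R]_n) (c delta eta0 Rk eta : R) : Prop :=
  let acc := accepts f w d c Rk in
  if acc eta0 then
    exists m : nat,
      [/\ forall j, (j <= m)%N -> acc (delta ^- j * eta0),
          ~~ acc (delta ^- m.+1 * eta0)
        & eta = delta ^- m * eta0]
  else
    exists m : nat,
      [/\ forall j, (j <= m)%N -> ~~ acc (delta ^+ j * eta0),
          acc (delta ^+ m.+1 * eta0)
        & eta = delta ^+ m.+1 * eta0].

Lemma enorm_sqr (R : realType) (n : nat) (u : 'rV[R]_n) :
  enorm u ^+ 2 = dot u u.
Proof.
by rewrite sqr_sqrtr // sumr_ge0 // => i _; rewrite -expr2 sqr_ge0.
Qed.

Lemma dotNr (R : realType) (n : nat) (u v : 'rV[R]_n) :
  dot u (- v) = - dot u v.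
Proof. by rewrite /dot -sumrN; apply: eq_bigr => i _; rewrite mxE mulrN. Qed.

Lemma accepts_steepest (R : realType) (n : nat) (f : 'rV[R]_n -> R)
    (w : 'rV[R]_n) (c eps eta : R) :
  accepts f w (- grad f w) c (f w + eps) eta =
  (f (w - eta *: grad f w) <= f w - c * eta * enorm (grad f w) ^+ 2 + eps).
Proof.
by rewrite /accepts enorm_sqr scalerN dotNr mulrN addrAC.
Qed.

(* Main.v *)
Require Import Defs.
From HB Require Import structures.
From mathcomp Require Import all_boot all_order all_algebra.
From mathcomp Require Import all_classical all_reals all_analysis.
From mathcomp Require Import ring lra.

Set Implicit Arguments.
Unset Strict Implicit.
Unset Printing Implicit Defensive.

Import Order.TTheory GRing.Theory Num.Theory.
Import numFieldNormedType.Exports.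

Local Open Scope ring_scope.

(* Write l for segment_lip f wk eta_w, w for wk and g for grad f w.  Along
   the segment the gradient is l-Lipschitz relative to w, so the descent lemma
   gives f (w - t g) <= f w - t |g|^2 + l t^2 |g|^2 / 2, which is at most
   f w - c t |g|^2 as soon as l t <= 2 (1 - c).  Since 2 / l <= eta_w,
   every step size up to 2 (1 - c) / l is accepted.  The search stops next to a
   rejected step size, namely etak / delta. *)

Lemma dotC (R : realType) (n : nat) (u v : 'rV[R]_n) : dot u v = dot v u.
Proof. by apply: eq_bigr => i _; rewrite mulrC. Qed.

Lemma dotDr (R : realType) (n : nat) (u v w : 'rV[R]_n) :
  dot u (v + w) = dot u v + dot u w.
Proof. by rewrite -big_split; apply: eq_bigr => i _; rewrite mxE mulrDr. Qed.

Lemma dotBr (R : realType) (n : nat) (u v w : 'rV[R]_n) :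
  dot u (v - w) = dot u v - dot u w.
Proof. by rewrite dotDr dotNr. Qed.

Lemma dotZr (R : realType) (n : nat) (a : R) (u v : 'rV[R]_n) :
  dot u (a *: v) = a * dot u v.
Proof. by rewrite mulr_sumr; apply: eq_bigr => i _; rewrite mxE mulrCA. Qed.

Lemma dot_ge0 (R : realType) (n : nat) (u : 'rV[R]_n) : 0 <= dot u u.
Proof. by rewrite -enorm_sqr sqr_ge0. Qed.

Lemma dot_eq0 (R : realType) (n : nat) (u : 'rV[R]_n) :
  (dot u u == 0) = (u == 0).
Proof.
apply/eqP/eqP => [u0|->]; last first.
  by apply: big1 => i _; rewrite mxE mul0r.
apply/rowP => i; rewrite mxE; apply/eqP.
have /eqP := u0; rewrite psumr_eq0 => [/allP/(_ i)|j _]; last first.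
  by rewrite -expr2 sqr_ge0.
by rewrite mem_index_enum /= mulf_eq0 orbb => /(_ isT).
Qed.

Lemma enorm_ge0 (R : realType) (n : nat) (u : 'rV[R]_n) : 0 <= enorm u.
Proof. exact: sqrtr_ge0. Qed.

Lemma enorm_eq0 (R : realType) (n : nat) (u : 'rV[R]_n) :
  (enorm u == 0) = (u == 0).
Proof. by rewrite -dot_eq0 -enorm_sqr sqrf_eq0. Qed.

Lemma enormZ (R : realType) (n : nat) (a : R) (u : 'rV[R]_n) :
  enorm (a *: u) = `|a| * enorm u.
Proof.
by rewrite /enorm dotZr dotC dotZr mulrA -expr2 sqrtrM ?sqr_ge0 // sqrtr_sqr.
Qed.

(** Cauchy-Schwarz: for nonzero [u] and [v], expand [0 <= dot x x] at
    [x = enorm v *: u - enorm u *: v] and cancel the positive factor [enorm u * enorm v]. *)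
Lemma dot_le_enorm (R : realType) (n : nat) (u v : 'rV[R]_n) :
  dot u v <= enorm u * enorm v.
Proof.
have [->|u0] := eqVneq u 0.
  rewrite (_ : dot 0 v = 0) ?mulr_ge0 ?enorm_ge0 //.
  by apply: big1 => i _; rewrite mxE mul0r.
have [->|v0] := eqVneq v 0.
  rewrite (_ : dot u 0 = 0) ?mulr_ge0 ?enorm_ge0 //.
  by apply: big1 => i _; rewrite mxE mulr0.
have up : 0 < enorm u by rewrite lt0r enorm_eq0 u0 enorm_ge0.
have vp : 0 < enorm v by rewrite lt0r enorm_eq0 v0 enorm_ge0.
rewrite -(ler_pM2l (mulr_gt0 up vp)).
have := dot_ge0 (enorm v *: u - enorm u *: v).
rewrite dotBr !dotZr ![dot (_ - _) _]dotC !dotBr !dotZr (dotC v u).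
rewrite -[dot u u]enorm_sqr -[dot v v]enorm_sqr.
nra.
Qed.

Lemma derive_dot_grad (R : realType) (n : nat) (f : 'rV[R]_n -> R)
    (w v : 'rV[R]_n) :
  differentiable f w -> 'D_v f w = dot (grad f w) v.
Proof.
move=> df; rewrite deriveE // [v in LHS]row_sum_delta linear_sum.
by apply: eq_bigr => i _; rewrite linearZ mxE deriveE // mulrC.
Qed.

Lemma is_derive_line (R : realType) (n : nat) (f : 'rV[R]_n -> R)
    (w d : 'rV[R]_n) (s : R) :
  differentiable f (w + s *: d) ->
  is_derive s 1 (fun r : R => f (w + r *: d)) (dot (grad f (w + s *: d)) d).
Proof.
move=> df; rewrite -derive_dot_grad //.
(* The difference quotient of the restriction to the line is that of the directional derivative
   along [d], so both limits agree. *)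
have quotient_eq :
    (fun h : R => h^-1 *:
       (((fun r : R => f (w + r *: d)) \o shift s) (h *: 1) -
        f (w + s *: d))) =
    (fun h : R => h^-1 *:
       ((f \o shift (w + s *: d)) (h *: d) - f (w + s *: d))).
  apply/funext => h /=; congr (_ *: (f _ - _)).
  by rewrite [h *: 1]mulr1 scalerDl addrCA.
split; last by rewrite /derive quotient_eq.
by rewrite /derivable quotient_eq; exact: diff_derivable.
Qed.

(** Descent lemma without integration: the mean value theorem is applied to [h], which is [f] on the
    line minus [D * s + K / 2 * s ^+ 2], and the hypothesis makes its derivative [dh]
    nonpositive. *)
Lemma descent_line (R : realType) (n : nat) (f : 'rV[R]_n -> R)
    (w d : 'rV[R]_n) (K t : R) :
  (forall x, differentiable f x) -> 0 <= t ->
  (forall s, 0 < s <= t ->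
     dot (grad f (w + s *: d)) d - dot (grad f w) d <= K * s) ->
  f (w + t *: d) <= f w + t * dot (grad f w) d + K / 2 * t ^+ 2.
Proof.
move=> df t0 lipK; set D := dot (grad f w) d.
pose h (s : R) : R := f (w + s *: d) - (D * s + K / 2 * s ^+ 2).
pose dh (s : R) : R := dot (grad f (w + s *: d)) d - (D + K * s).
have hE (s : R) : is_derive s 1 h (dh s).
  apply: is_deriveB; first exact: is_derive_line.
  by apply: is_derive_eq; rewrite /GRing.scale /=; field.
have h_cont : {within `[0, t], continuous h}%classic.
  by apply: derivable_within_continuous => s _; case: (hE s).
have [s /[!in_itv]/= /andP[s0 st]] := MVT_segment t0 (fun x _ => hE x) h_cont.
rewrite /h scale0r addr0 subr0 => hts.
suff : dh s * t <= 0 by lra.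
apply: mulr_le0_ge0 => //; rewrite /dh.
(* The mean value point may be the endpoint [0], which [lipK] does not cover; there [dh]
   vanishes. *)
move: s0; rewrite le_eqVlt => /predU1P[<-|s_gt0].
  by rewrite scale0r addr0 /D; lra.
by have := lipK s; rewrite s_gt0 st -/D => /(_ isT); lra.
Qed.

Lemma segment_lip_le (R : realType) (n : nat) (f : 'rV[R]_n -> R)
    (w : 'rV[R]_n) (eta l t : R) :
  segment_lip f w eta = l%:E -> 0 < t <= eta ->
  enorm (grad f w - grad f (gd_step f w t)) <= l * (t * enorm (grad f w)).
Proof.
move=> lE t_eta; have /andP[t0 _] := t_eta.
have step_norm : enorm (w - gd_step f w t) = t * enorm (grad f w).
  by rewrite /gd_step opprB addrCA subrr addr0 enormZ gtr0_norm.
(* At a critical point the quotient is 0/0, but the step does not move and both sides are zero. *)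
have [g0|g_neq0] := eqVneq (grad f w) 0.
  have norm0 : enorm (0 : 'rV[R]_n) = 0 by apply/eqP; rewrite enorm_eq0.
  by rewrite /gd_step g0 scaler0 subr0 g0 subr0 norm0 !mulr0.
have g_gt0 : 0 < enorm (grad f w) by rewrite lt0r enorm_eq0 g_neq0 enorm_ge0.
rewrite -ler_pdivrMr ?mulr_gt0 // -lee_fin -lE -step_norm.
by apply: ereal_sup_ubound; exists t.
Qed.

Lemma accepts_small_step (R : realType) (n : nat) (f : 'rV[R]_n -> R)
    (w : 'rV[R]_n) (c eps eta l t : R) :
  (forall x, differentiable f x) -> segment_lip f w eta = l%:E ->
  0 <= eps -> 0 < t <= eta -> l * t <= 2 * (1 - c) ->
  accepts f w (- grad f w) c (f w + eps) t.
Proof.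
move=> df lE eps0 /andP[t0 t_eta] lt; set g := grad f w.
(* Here [K = l * dot g g]: by Cauchy-Schwarz the left side is at most the norm of the gradient
   difference, bounded by [l * (s * enorm g)], times [enorm g]. *)
have lip s : 0 < s <= t ->
    dot (grad f (w + s *: - g)) (- g) - dot g (- g) <= l * dot g g * s.
  move=> /andP[s0 st]; rewrite scalerN -/(gd_step f w s) !dotNr.
  rewrite !(dotC _ g) -opprD -dotBr -dotNr opprB dotC.
  apply: (le_trans (dot_le_enorm _ _)).
  rewrite -enorm_sqr expr2 mulrAC mulrA ler_wpM2r ?enorm_ge0 //.
  rewrite -mulrA.
  by apply: (segment_lip_le lE); rewrite s0 (le_trans st).
have := descent_line df (ltW t0) lip.
rewrite /accepts -/g !dotNr.
(* The step size bound times [t * dot g g]; half of it absorbs the quadratic term of the descent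
   lemma. *)
have : l * t * (t * dot g g) <= 2 * (1 - c) * (t * dot g g).
  by rewrite ler_wpM2r // mulr_ge0 ?dot_ge0 // ltW.
set F := f _; set G := f w; set D := dot g g.
nra.
Qed.

(** [eta / delta] is the test that ends a growing search, and the last test before acceptance in a
    shrinking one (the initial step size if [m = 0]). *)
Lemma equality_line_search_rejects (R : realType) (n : nat)
    (f : 'rV[R]_n -> R) (w d : 'rV[R]_n) (c delta eta0 Rk eta : R) :
  delta != 0 -> equality_line_search f w d c delta eta0 Rk eta ->
  ~~ accepts f w d c Rk (eta / delta).
Proof.
move=> delta0; rewrite /equality_line_search /=.
case: ifP => _ [m [rej_before rej_next ->]].
  by rewrite mulrAC -exprVn -exprSr exprVn.
by rewrite exprSr mulrAC mulfK // rej_before.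
Qed.

Theorem proposition2p5 (R : realType) (n : nat) (f : 'rV[R]_n -> R)
    (f_C1 : C1 f) (f_smooth : segment_smooth f)
    (c delta : R) (c01 : 0 < c < 1) (delta01 : 0 < delta < 1)
    (wk : 'rV[R]_n)
    (* eta_w is the value $\eta_{w_k}$ of the segment smoothness condition *)
    (eta_w : R) (eta_w_gt0 : 0 < eta_w)
    (l_fin : (segment_lip f wk eta_w < +oo)%E)
    (l_gt0 : (0 < segment_lip f wk eta_w)%E)
    (eta_w_ge : (2%:E / segment_lip f wk eta_w <= eta_w%:E)%E)
    (epsk : R) (epsk_ge0 : 0 <= epsk)
    (etak0 : R) (etak0_gt0 : 0 < etak0)
    (etak : R) (etak_gt0 : 0 < etak)
    (search : equality_line_search f wk (- grad f wk) c delta etak0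
                (f wk + epsk) etak) :
  ((2 * delta * (1 - c))%:E / segment_lip f wk eta_w <= etak%:E)%E.
Proof.
have [df _] := f_C1; have /andP[c0 c1] := c01; have /andP[d0 d1] := delta01.
have := equality_line_search_rejects (lt0r_neq0 d0) search.
have lE : segment_lip f wk eta_w = (fine (segment_lip f wk eta_w))%:E.
  by rewrite fineK // ge0_fin_numE // ltW.
move: l_gt0 eta_w_ge; rewrite lE; set l := fine _.
rewrite lte_fin => l0; rewrite inver gt_eqF // -!EFinM !lee_fin.
(* By contraposition: if [etak] were below the bound, [etak / delta] would be short enough to be
   accepted. *)
move=> le_eta_w; apply: contraNT; rewrite -ltNge => etak_lt.
have lt_r : l * (etak / delta) < 2 * (1 - c).
  move: etak_lt; rewrite ltr_pdivlMr // mulrA ltr_pdivrMr //; lra.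
apply: (accepts_small_step df lE) => //; last exact: ltW.
(* The step stays in the segment where [l] is valid: [c > 0] gives [etak / delta < 2 / l], and
   [2 / l <= eta_w]. *)
rewrite divr_gt0 //=; apply: le_trans le_eta_w.
rewrite ler_pdivlMr // mulrC; lra.
Qed.
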